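(* Let $X$ be a complete Hausdorff semitopological semilattice. Then the topologies $w^\bullet_X$ and $\mathcal W^\bullet_X$ coincide if one of the following conditions is satisfied: (1) $X$ is a topological semilattice; (2) $X$ is a sequential space; (3) $X$ is a $\vec T_{2\delta}$-space; (4) $X$ is functionally Hausdorff.
   Context: A semilattice is a commutative semigroup of idempotents, ordered by $x\le y$ iff $xy=x$. A semilattice with a topology is a semitopological (resp. topological) semilattice if the operation $X\times X\to X$, $(x,y)\mapsto xy$, is separately (resp. jointly) continuous. It is complete if each non-empty chain $C\subset X$ has an infimum and a supremum in $X$ with $\inf C\in\bar C$ and $\sup C\in\bar C$ (closure in $X$). The weak$^\bullet$ topology $w^\bullet_X$ on $X$ is generated by the subbase of complements to closed subsemilattices of $X$. A subset $D$ of a poset is up-directed (resp. down-directed) if for all $x,y\in D$ there is $z\in D$ with $x\le z$ and $y\le z$ (resp. $z\le x$ and $z\le y$). A subset $A\subset X$ is Dedekind closed if it contains $\sup D$ for every non-empty up-directed $D\subset A$ that has a supremum in $X$, and contains $\inf D$ for every non-empty down-directed $D\subset A$ that has an infimum in $X$. The lower complete topology $\mathcal W^\bullet_X$ is generated by the subbase consisting of complements to Dedekind closed subsemilattices of $X$ (it depends only on the semilattice $X$, not on its topology). A topological space $X$ is sequential if for each non-closed $A\subset X$ there is a sequence in $A$ converging to a point of $X\setminus A$. A space $Y$ is a $T_{2\delta}$-space if it is a $T_1$-space and for any open set $U\subset Y$ and $x\in U$ there is a countable family $\mathcal U$ of closed neighborhoods of $x$ in $Y$ with $\bigcap\mathcal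 U\subset U$. A space $X$ is a $\vec T_{2\delta}$-space if it admits an injective continuous map to a $T_{2\delta}$-space. $X$ is functionally Hausdorff if for any distinct $x,y\in X$ there is a continuous function $f:X\to\mathbb R$ with $f(x)\ne f(y)$. *)

(* Defs.v *)
From HB Require Import structures.
From mathcomp Require Import all_boot all_order all_algebra.
From mathcomp Require Import all_classical all_reals all_analysis.

Set Implicit Arguments.
Unset Strict Implicit.
Unset Printing Implicit Defensive.

Import Order.TTheory numFieldNormedType.Exports.

Local Open Scope classical_set_scope.

(** The order is a structure of its own, tied to the product by the last
    axiom.  [Order.MeetSemilattice] is not used because Hierarchy Builder
    rejects its join with [Topological]: the library's [OrderNbhs] already
    inherits from both sides. *)
HB.mixin Record Semigroup_isSemilattice d T
    & Semigroup T & Order.POrder d T := {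
  semilattice_mulC : commutative (fun x y : T => (x * y)%g);
  semilattice_mulxx : idempotent_op (fun x y : T => (x * y)%g);
  semilattice_leE : forall x y : T, (x <= y)%O <-> (x * y)%g = x
}.

#[short(type="semilatticeType")]
HB.structure Definition Semilattice d :=
  { T of Semigroup T & Order.POrder d T & Semigroup_isSemilattice d T }.

(** No compatibility between the product and the topology is built in. *)
#[short(type="topologizedSemilatticeType")]
HB.structure Definition TopologizedSemilattice d :=
  { T of Topological T & Semilattice d T }.

Section order_notions.
Context {d : Order.disp_t} {T : semilatticeType d}.
Implicit Types A C D : set T.

Definition subsemilattice A :=
  forall x y, A x -> A y -> A (x * y)%g.

Definition chain C := total_on C (fun x y => (x <= y)%O).

Definition up_directed D :=
  forall x y, D x -> D y -> exists z, [/\ D z, (x <= z)%O & (y <= z)%O].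

Definition down_directed D :=
  forall x y, D x -> D y -> exists z, [/\ D z, (z <= x)%O & (z <= y)%O].

Definition dedekind_closed A :=
  (forall D, D `<=` A -> D !=set0 -> up_directed D ->
     forall s, supremums D s -> A s) /\
  (forall D, D `<=` A -> D !=set0 -> down_directed D ->
     forall i, infimums D i -> A i).

End order_notions.

Section topological_semilattices.
Context {d : Order.disp_t}.
Implicit Type X : topologizedSemilatticeType d.

Definition semitopological_semilattice X :=
  (forall x : X, continuous (fun y : X => (x * y)%g)) /\
  (forall y : X, continuous (fun x : X => (x * y)%g)).

Definition topological_semilattice X :=
  continuous (fun p : X * X => (p.1 * p.2)%g).

Definition complete_semilattice X :=
  forall C : set X, C !=set0 -> chain C ->
    (exists2 i, infimums C i & closure C i) /\
    (exists2 s, supremums C s & closure C s).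

End topological_semilattices.

(** As [T] already carries a topology, the topologies [w^\bullet] and
    [\mathcal W^\bullet] are put on aliases of [T]. *)
Section weak_bullet.
Context {d : Order.disp_t} (T : topologizedSemilatticeType d).

Definition weak_bullet : Type := T.

Definition weak_bullet_subbase : set (set weak_bullet) :=
  [set ~` (A : set T) | A in [set A | @closed T A /\ subsemilattice A]].

HB.instance Definition _ := Choice.on weak_bullet.
HB.instance Definition _ :=
  isSubBaseTopological.Build weak_bullet weak_bullet_subbase id.

End weak_bullet.

Section lower_complete.
Context {d : Order.disp_t} (T : semilatticeType d).

Definition lower_complete : Type := T.

Definition lower_complete_subbase : set (set lower_complete) :=
  [set ~` (A : set T) | A in [set A | dedekind_closed A /\ subsemilattice A]].

HB.instance Definition _ := Choice.on lower_complete.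
HB.instance Definition _ :=
  isSubBaseTopological.Build lower_complete lower_complete_subbase id.

End lower_complete.

Definition sequential_space (X : topologicalType) :=
  forall A : set X, ~ closed A ->
    exists (u : nat -> X) (x : X),
      [/\ forall n, A (u n), ~ A x & u @ \oo --> x].

Definition T2delta_space (Y : topologicalType) :=
  accessible_space Y /\
  forall (U : set Y) (x : Y), open U -> U x ->
    exists F : set (set Y),
      [/\ countable F, forall V, F V -> closed V /\ nbhs x V &
          \bigcap_(V in F) V `<=` U].

Definition vec_T2delta_space (X : topologicalType) :=
  exists (Y : topologicalType) (f : X -> Y),
    [/\ T2delta_space Y, injective f & continuous f].

Definition functionally_hausdorff (R : realType) (X : topologicalType) :=
  forall x y : X, x <> y -> exists2 f : X -> R, continuous f & f x <> f y.

Definition weak_bullet_topology {d : Order.disp_t}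
    (X : topologizedSemilatticeType d) : set (set X) :=
  @open (weak_bullet X).

Definition lower_complete_topology {d : Order.disp_t}
    (X : semilatticeType d) : set (set X) :=
  @open (lower_complete X).

Arguments weak_bullet_topology {d} X _.
Arguments lower_complete_topology {d} X _.

(* Main.v *)
Require Import Defs.
From HB Require Import structures.
From mathcomp Require Import all_boot all_order all_algebra.
From mathcomp Require Import finmap.
From mathcomp Require Import all_classical all_reals all_analysis.

(** Both topologies are generated by complements of subsemilattices, so it is
    enough that a subsemilattice is closed iff it is Dedekind closed.

    Both properties imply that it contains the infima and suprema of its
    non-empty chains ([chain_closed]), and conversely a chain-closed
    subsemilattice is Dedekind closed.  For this, Zorn's lemma enlarges a set
    [S] as long as all sets [S `|` [set p]] have an infimum (an upper bound) in
    the subsemilattice: [infimum_exists], [up_directed_ubound].  In particular a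
    closed subsemilattice is Dedekind closed, whatever the extra hypothesis.

    What remains is that a chain-closed subsemilattice [A] contains every point
    [x] of its closure, that is, that [A] reaches [x] by suprema of infima.
    Lower limits of families of points of [A] are the tool: the supremum [c] of
    the infima of the tails lies in [A], and it lies in the closure of every
    subsemilattice that contains some tail ([lower_limit_exists]).  The points
    of the family are chosen one after the other, each so close to [x] that the
    products with the points chosen before stay close to [x]
    ([small_products]); separate continuity allows this because there are
    finitely many conditions at each step and [x * x = x].

    - If multiplication is jointly continuous, sequences [U] of neighborhoods
      of [x] with [U n.+1 * U n.+1] inside [U n] have closed subsemilattices
      [\bigcap_n closure (U n)], which meet [A].  The least points of these
      intersections form an up-directed set, whose supremum lies in all of them,
      hence is [x].
    - If [X] is sequential, take a sequence of points of [A] that converges to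
      [x].  Lower limits grow when the sequence is thinned out.  By
      sequentiality, chains without maximum have countable cofinality, so Zorn's
      lemma and a diagonal argument give a subsequence whose lower limit [c] is
      that of all its subsequences.  One of these has its lower limit in the
      closure of any given neighborhood of [x], so [c = x].
    - If [X] maps injectively and continuously to a T2delta space, or is
      functionally Hausdorff, there is a family of open sets such that [c = x]
      as soon as [c * z] belongs to all members of the family that contain
      [x * z], for all [z] ([delta_regular_chain_closed_closed]).  Countably
      many of these conditions are met by a lower limit of a sequence
      ([closure_countable_meet]).  For all conditions at once, countable sets of
      conditions are enlarged transfinitely.  A union of a chain of sets of
      conditions, each with a solution in [A], is solved by a lower limit of the
      solutions, provided that every solution also obeys the conditions
      translated by the earlier solutions.  To make this proviso compatible with
      adding a condition, solutions are not attached to single sets of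
      conditions but to monotone systems indexed by finite sets of data
      ([approximation]), to which Zorn's lemma applies
      ([closure_meet_family]). *)

Set Implicit Arguments.
Unset Strict Implicit.
Unset Printing Implicit Defensive.

Import Order.TTheory numFieldNormedType.Exports.

Local Open Scope classical_set_scope.
Local Open Scope group_scope.

(** * Infima, suprema and chains in a semilattice *)

Section semilattice_theory.
Context {d : Order.disp_t} {T : semilatticeType d}.
Implicit Types (A C D P Q S : set T) (x y z : T).

Lemma slmulC x y : x * y = y * x.
Proof. exact: semilattice_mulC. Qed.

Lemma slmulxx x : x * x = x.
Proof. exact: semilattice_mulxx. Qed.

Lemma slmul_leP x y : reflect (x * y = x) (x <= y)%O.
Proof. by apply: (iffP idP) => /semilattice_leE. Qed.

Lemma slmul_lel x y : (x * y <= x)%O.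
Proof. by apply/slmul_leP; rewrite slmulC mulgA slmulxx. Qed.

Lemma slmul_ler x y : (x * y <= y)%O.
Proof. by rewrite slmulC slmul_lel. Qed.

Lemma le_slmul z x y : (z <= x)%O -> (z <= y)%O -> (z <= x * y)%O.
Proof.
by move=> /slmul_leP zx /slmul_leP zy; apply/slmul_leP; rewrite mulgA zx.
Qed.

Definition chain_closed A := forall C, C `<=` A -> C !=set0 -> chain C ->
  infimums C `<=` A /\ supremums C `<=` A.

Definition chain_complete :=
  forall C, C !=set0 -> chain C -> infimums C !=set0 /\ supremums C !=set0.

Lemma chain_closedI A C : chain_closed A -> chain_closed C ->
  chain_closed (A `&` C).
Proof.
move=> Acl Ccl E EAC E0 Ech.
have [AiE AsE] := Acl E (fun _ h => (EAC _ h).1) E0 Ech.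
have [CiE CsE] := Ccl E (fun _ h => (EAC _ h).2) E0 Ech.
by split=> z Ez; split; [exact: AiE|exact: CiE|exact: AsE|exact: CsE].
Qed.

Lemma subsemilatticeI A C : subsemilattice A -> subsemilattice C ->
  subsemilattice (A `&` C).
Proof. by move=> As Cs x y [? ?] [? ?]; split; [exact: As|exact: Cs]. Qed.

Lemma chain_closed_ge x : chain_closed [set y | (y <= x)%O].
Proof.
move=> C Cx [c Cc] _; split=> z [z1 z2] /=; last exact: z2.
by apply: le_trans (z1 _ Cc) (Cx _ Cc).
Qed.

Lemma subsemilattice_ge x : subsemilattice [set y | (y <= x)%O].
Proof. by move=> y z /= yx _; apply: le_trans (slmul_lel _ _) yx. Qed.

Lemma dedekind_closed_chain_closed A : dedekind_closed A -> chain_closed A.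
Proof.
move=> [Au Ad] C CA C0 Cch; split.
  apply: Ad => // x y Cx Cy; case: (Cch x y Cx Cy) => xy.
    by exists x.
  by exists y.
apply: Au => // x y Cx Cy; case: (Cch x y Cx Cy) => xy.
  by exists y.
by exists x.
Qed.

Lemma infimum_unique A x y : infimums A x -> infimums A y -> x = y.
Proof. by move=> Ax Ay; apply: is_subset1_infimums Ax Ay. Qed.

Lemma supremum_unique A x y : supremums A x -> supremums A y -> x = y.
Proof. by move=> Ax Ay; apply: is_subset1_supremums Ax Ay. Qed.

Lemma infimum_le A C x y : A `<=` C -> infimums A x -> infimums C y ->
  (y <= x)%O.
Proof. by move=> AC [_ Ax] [Cy _]; apply: Ax => z /AC; apply: Cy. Qed.

(** Products replace pairs: the infimum of [S' `|` [set e] `|` [set p]] is that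
    of [S' `|` [set e * p]].  Thus the property that [S' `|` [set p]] has an
    infimum in [Q] for every [p] in [P] passes from [S'] to [S' `|` [set e]],
    and it passes to unions of chains because the infima form a chain in [Q].
    As infima of chains may leave [P], a second set [Q] is needed, such as the
    closure of [P]. *)
Lemma infimum_exists P Q S : chain_complete ->
    subsemilattice P -> P `<=` Q -> chain_closed Q ->
    S `<=` P -> S !=set0 ->
  exists2 i, infimums S i & Q i.
Proof.
move=> cX Psub PQ Qcl SP [s0 Ss0].
pose good S' := S' `<=` S /\
  forall p, P p -> exists2 i, infimums (S' `|` [set p]) i & Q i.
have good0 : good set0.
  by split=> // p Pp; exists p; rewrite ?set0U ?infimums1//; exact: PQ.
have [F Fgood Ftot|M [[MS Mgood] Mmax]] := @Zorn_bigcup T good.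
  split=> [x [S' FS' S'x]|p Pp]; first exact: (Fgood _ FS').1 _ S'x.
  (* [set0] is added so that [C] is non-empty even if [F] is empty. *)
  pose F' := F `|` [set set0].
  pose C := [set i | exists2 S', F' S' & infimums (S' `|` [set p]) i].
  have F'good S' : F' S' -> good S' by case=> [/Fgood//|->].
  have Ctot : chain C.
    move=> i j [A FA iA] [B FB jB].
    have [AB|BA] : A `<=` B \/ B `<=` A.
      case: FA FB => [FA|->] [FB|->]; [exact: Ftot|by right|by left|by left].
    - by right; apply: infimum_le iA jB; apply: setSU.
    - by left; apply: infimum_le jB iA; apply: setSU.
  have C0 : C !=set0.
    by exists p; exists set0; [right|rewrite set0U infimums1].
  have CQ : C `<=` Q.
    move=> i [S' /F'good[_ /(_ p Pp)[j jS' Qj]] iS'].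
    by rewrite (infimum_unique iS' jS').
  have [[i iC] _] := cX C C0 Ctot.
  exists i; last exact: (Qcl C CQ C0 Ctot).1.
  split=> [x [[S' FS' S'x]|->]|y yF].
  - have [_ /(_ p Pp)[j jS' _]] := Fgood _ FS'.
    apply: (@le_trans _ _ j); last by apply: jS'.1; left.
    by apply: iC.1; exists S' => //; left.
  - by apply: iC.1; exists set0; [right|rewrite set0U infimums1].
  - apply: iC.2 => j [S' FS' jS']; apply: jS'.2 => x [S'x|->].
      case: FS' S'x => [FS' S'x|-> //].
      by apply: yF; left; exists S'.
    by apply: yF; right.
suff MSE : M = S.
  have [i iM Qi] := Mgood _ (SP _ Ss0); exists i => //.
  suff <- : M `|` [set s0] = S by [].
  by rewrite MSE; apply: setUidl => x ->.
apply/seteqP; split=> // s Ss; apply: contrapT => Ms.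
apply: (Mmax (M `|` [set s])).
  split; first exact: subsetUl.
  by move=> /(_ s) h; apply: Ms; apply: h; right.
split=> [x [/MS//|->//]|p Pp].
have [i iM Qi] := Mgood _ (Psub _ _ (SP _ Ss) Pp).
exists i => //; split=> [x [[Mx|->]|->]|y yM].
- by apply: iM.1; left.
- by apply: le_trans (slmul_lel s p); apply: iM.1; right.
- by apply: le_trans (slmul_ler s p); apply: iM.1; right.
- apply: iM.2 => x [Mx|->]; first by apply: yM; left; left.
  by apply: le_slmul; apply: yM; [left; right|right].
Qed.

(** This replaces the decomposition of a directed set into a well-ordered union
    of smaller directed sets.  Among the upper bounds of [S `|` [set p]] that
    lie in [A] there is a least one; it grows with [S], so along a chain of
    sets [S] these least upper bounds form a chain, whose supremum is an upper
    bound for the union.  Directedness of [D] serves to add an element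
    [e] to [S]: if [e <= q] and [p <= q], an upper bound of [S `|` [set q]]
    bounds [S `|` [set e] `|` [set p]]. *)
Lemma up_directed_ubound A D : chain_complete ->
    subsemilattice A -> chain_closed A ->
    D `<=` A -> D !=set0 -> up_directed D ->
  exists2 u, A u & ubound D u.
Proof.
move=> cX Asub Acl DA [d0 Dd0] Ddir.
pose good S := S `<=` D /\
  forall p, D p -> exists2 u, A u & ubound (S `|` [set p]) u.
have good0 : good set0.
  by split=> // p Dp; exists p; rewrite ?set0U//; [exact: DA|move=> ? ->].
have least S p : good S -> D p ->
    exists2 i, infimums (A `&` ubound (S `|` [set p])) i & A i.
  move=> [_ Sgood] /Sgood[u Au uS].
  apply: (infimum_exists cX Asub) => //; last by exists u.
have [F Fgood Ftot|M [[MD Mgood] Mmax]] := @Zorn_bigcup T good.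
  split=> [x [S' FS' S'x]|p Dp]; first exact: (Fgood _ FS').1 _ S'x.
  pose F' := F `|` [set set0].
  pose C := [set i | exists2 S', F' S' &
                     infimums (A `&` ubound (S' `|` [set p])) i].
  have F'good S' : F' S' -> good S' by case=> [/Fgood//|->].
  have Ctot : chain C.
    move=> i j [S FS iS] [S' FS' jS'].
    have mono U V : U `<=` V ->
        A `&` ubound (V `|` [set p]) `<=` A `&` ubound (U `|` [set p]).
      move=> UV; apply: setIS => u uV x [/UV Vx|->]; apply: uV; [by left|].
      by right.
    have [SS'|S'S] : S `<=` S' \/ S' `<=` S.
      case: FS FS' => [FS|->] [FS'|->]; [exact: Ftot|by right|by left|by left].
    - by left; apply: infimum_le jS' iS; apply: mono.
    - by right; apply: infimum_le iS jS'; apply: mono.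
  have C0 : C !=set0.
    by have [i iS _] := least _ _ good0 Dp; exists i; exists set0 => //; right.
  have CA : C `<=` A.
    move=> i [S' /F'good S'good iS']; have [j jS' Aj] := least _ _ S'good Dp.
    by rewrite (infimum_unique iS' jS').
  have CubF' S' i : F' S' -> infimums (A `&` ubound (S' `|` [set p])) i ->
      ubound (S' `|` [set p]) i.
    by move=> _ iS' x S'x; apply: iS'.2 => u [_]; apply.
  have [_ [s sC]] := cX C C0 Ctot.
  exists s; first exact: (Acl C CA C0 Ctot).2.
  move=> x [[S' FS' S'x]|->].
    have FS'' : F' S' by left.
    have [i iS' _] := least _ _ (F'good _ FS'') Dp.
    apply: (@le_trans _ _ i); last by apply: sC.1; exists S'.
    by apply: CubF' iS' _ _ => //; left.
  have F0 : F' set0 by right.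
  have [i iS' _] := least _ _ good0 Dp.
  apply: (@le_trans _ _ i); last by apply: sC.1; exists set0.
  by apply: CubF' iS' _ _ => //; right.
suff MDE : M = D.
  have [u Au uM] := Mgood _ Dd0; exists u => // x.
  by rewrite -MDE => Mx; apply: uM; left.
apply/seteqP; split=> // e De; apply: contrapT => Me.
apply: (Mmax (M `|` [set e])).
  split; first exact: subsetUl.
  by move=> /(_ e) h; apply: Me; apply: h; right.
split=> [x [/MD//|->//]|p Dp].
have [q [Dq eq pq]] := Ddir _ _ De Dp.
have [u Au uM] := Mgood _ Dq; exists u => // x [[Mx|->]|->].
- by apply: uM; left.
- by apply: le_trans eq _; apply: uM; right.
- by apply: le_trans pq _; apply: uM; right.
Qed.

Lemma up_directed_supremum_exists D : chain_complete ->
  D !=set0 -> up_directed D -> supremums D !=set0.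
Proof.
move=> cX D0 Ddir.
have Tsub : subsemilattice [set: T] by [].
have Tcl : chain_closed [set: T] by [].
have [u _ uD] := up_directed_ubound cX Tsub Tcl (@subsetT _ D) D0 Ddir.
have [||i iU _] := @infimum_exists _ _ (ubound D) cX Tsub (@subsetT _ _) Tcl.
- exact: subsetT.
- by exists u.
exists i; split=> [x Dx|v vD]; last exact: iU.1.
by apply: iU.2 => v; apply.
Qed.

(** An upper bound of [D] in [A] that is at most [s] can only be [s]; so the
    suprema are found by applying [up_directed_ubound] to the part of [A]
    below [s]. *)
Lemma subsemilattice_chain_dedekind_closed A : chain_complete ->
  subsemilattice A -> chain_closed A -> dedekind_closed A.
Proof.
move=> cX Asub Acl; split=> D DA D0 Ddir s sD.
  pose B := A `&` [set y | (y <= s)%O].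
  have Bsub : subsemilattice B.
    exact: subsemilatticeI Asub (@subsemilattice_ge s).
  have Bcl : chain_closed B by apply: chain_closedI Acl (@chain_closed_ge s).
  have DB : D `<=` B by move=> x Dx; split; [exact: DA|exact: sD.1].
  have [u [Au us] uD] := up_directed_ubound cX Bsub Bcl DB D0 Ddir.
  suff -> : s = u by [].
  by apply: le_anti; rewrite sD.2.
have [i iD Ai] := infimum_exists cX Asub (@subset_refl _ A) Acl DA D0.
by rewrite (infimum_unique sD iD).
Qed.

End semilattice_theory.

(** * Ordered products *)

Section ordered_products.
Context {d : Order.disp_t} {T : semilatticeType d}.
Context {I : Type} (J : set I) (Q : I -> I -> Prop) (b : I -> T).

(** The index is that of the last factor, which is larger than all others. *)
Inductive ordered_product : I -> T -> Prop :=
| ordered_product1 j : J j -> ordered_product j (b j)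
| ordered_productS j k y : ordered_product j y -> J k -> Q j k ->
    ordered_product k (b k * y).

Hypothesis Qtotal : forall i j, J i -> J j -> [\/ i = j, Q i j | Q j i].

Lemma ordered_product_insert j k y : ordered_product j y -> J k ->
  exists2 l, l = k \/ l = j & ordered_product l (b k * y).
Proof.
elim=> {j y} [j Jj|j l y jy IH Jl jl] Jk.
  case: (Qtotal Jj Jk) => [->|jk|kj].
  - by exists k; [left|rewrite slmulxx; exact: ordered_product1].
  - by exists k; [left|apply: (ordered_productS (ordered_product1 Jj))].
  - exists j; [by right|rewrite slmulC].
    exact: (ordered_productS (ordered_product1 Jk)).
case: (Qtotal Jl Jk) => [<-|lk|kl].
- by exists l; [left|rewrite mulgA slmulxx; exact: ordered_productS jy _ _].
- exists k; [by left|apply: ordered_productS lk => //].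
  exact: ordered_productS jy _ _.
- have [m mE my] := IH Jk.
  exists l; first by right.
  rewrite mulgA (slmulC (b k)) -mulgA.
  by apply: (ordered_productS my Jl); case: mE => ->.
Qed.

(** By commutativity and idempotence, every product of values of [b] can be
    sorted and freed of repetitions.  Hence facts about all finite products
    can be proved by adding factors in increasing order only. *)
Lemma subsemilattice_ordered_product :
  subsemilattice [set y | exists j, ordered_product j y].
Proof.
move=> y z [j jy] /= [k kz].
elim: jy => {j y} [j Jj|j l y jy [m IH] Jl jl].
  by have [l _ ?] := ordered_product_insert kz Jj; exists l.
rewrite -mulgA.
by have [n _ ?] := ordered_product_insert IH Jl; exists n.
Qed.

End ordered_products.

(** * Complete semitopological semilattices *)

Section topological.
Context {d : Order.disp_t} {X : topologizedSemilatticeType d}.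
Implicit Types (A B C D E P : set X) (x y z : X).

Lemma complete_chain_complete : complete_semilattice X ->
  @chain_complete d X.
Proof.
by move=> cX C C0 Cch; have [[i ? _] [s ? _]] := cX C C0 Cch; split;
  [exists i|exists s].
Qed.

Lemma closed_chain_closed A : complete_semilattice X -> closed A ->
  chain_closed A.
Proof.
move=> cX Acl C CA C0 Cch.
have [[i iC iclC] [s sC sclC]] := cX C C0 Cch.
split=> z zC; apply: Acl; apply: (closure_subset CA).
  by rewrite (infimum_unique zC iC).
by rewrite (supremum_unique zC sC).
Qed.

(** For the tails [S] of a family of points, [c] is the lower limit of the
    family.  The tails [u] inside [t] have the same supremum of infima as all
    tails; each of these infima lies in the closure of [P] by
    [infimum_exists], hence so does the supremum. *)
Lemma lower_limit_exists (S : set (set X)) A : complete_semilattice X ->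
    subsemilattice A -> chain_closed A ->
    S !=set0 -> total_on S subset ->
    (forall t, S t -> t `<=` A /\ t !=set0) ->
  exists c, [/\ supremums [set i | exists2 t, S t & infimums t i] c, A c &
    forall t P, S t -> subsemilattice P -> t `<=` P -> closure P c].
Proof.
move=> cX Asub Acl [t0 St0] Stot SA.
have cX' := complete_chain_complete cX.
have inft t : S t -> exists2 i, infimums t i & A i.
  move=> /SA[tA t0'].
  exact: infimum_exists cX' Asub (@subset_refl _ A) _ _ _.
have tot S' : S' `<=` S -> chain [set i | exists2 t, S' t & infimums t i].
  move=> S'S i j [t /S'S tS ti] [u /S'S uS uj].
  by case: (Stot _ _ tS uS) => tu; [right|left]; apply: infimum_le tu _ _.
set C := [set i | _].
have C0 : C !=set0 by have [i ? _] := inft _ St0; exists i; exists t0.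
have [_ [c cC]] := cX' C C0 (tot _ (@subset_refl _ S)).
exists c; split=> //.
  apply: (Acl C _ C0 (tot _ (@subset_refl _ S))).2 => //.
  move=> i [t tS ti]; have [j tj Aj] := inft t tS.
  by rewrite (infimum_unique ti tj).
move=> t P tS Psub tP.
pose S' u := S u /\ u `<=` t.
pose C' := [set i | exists2 t, S' t & infimums t i].
have C'P : C' `<=` closure P.
  move=> i [u [uS ut] ui].
  have [||j uj Pj] := infimum_exists cX' Psub (@subset_closure _ P) _
    (subset_trans ut tP).
  - exact: closed_chain_closed cX (@closed_closure _ P).
  - exact: (SA _ uS).2.
  by rewrite (infimum_unique ui uj).
have C'0 : C' !=set0.
  by have [i ti _] := inft t tS; exists i; exists t => //; split.
have C'ch : chain C' by apply: tot => u [].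
apply: (closed_chain_closed cX (@closed_closure _ P) C'P C'0 C'ch).2.
split=> [i [u [uS _] ui]|y yC']; first by apply: cC.1; exists u.
apply: cC.2 => i [u uS ui].
case: (Stot _ _ uS tS) => ut; first by apply: yC'; exists u => //; split.
have [j tj _] := inft t tS.
apply: (@le_trans _ _ j); first exact: infimum_le ut tj ui.
by apply: yC'; exists t => //; split.
Qed.

Lemma open_mulr (y : X) E : semitopological_semilattice X ->
  open E -> open [set z | E (z * y)].
Proof. by move=> [_ /(_ y) yc] oE; move/continuousP: yc; apply. Qed.

Lemma open_mull (y : X) E : semitopological_semilattice X ->
  open E -> open [set z | E (y * z)].
Proof. by move=> [/(_ y) yc _] oE; move/continuousP: yc; apply. Qed.

(** The points are chosen within shrinking neighborhoods [D n] of [x], where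
    [D n.+1] is so small that [a n * z] stays in [D n] for [z] in [D n.+1].
    Induction on the number of factors then keeps a product of points whose
    first index is at least [k] inside [D k]. *)
Lemma small_products x (E B : nat -> set X) : semitopological_semilattice X ->
    (forall n, open (E n) /\ E n x) -> (forall n, closure (B n) x) ->
  exists2 a : nat -> X, (forall n, B n (a n)) &
    forall k, exists P, [/\ subsemilattice P, P `<=` E k &
      forall j, (k <= j)%N -> P (a j)].
Proof.
move=> stX Eo xB.
have pick (nD : nat * set X) : exists a,
    open nD.2 -> nD.2 x -> [/\ B nD.1 a, nD.2 a & nD.2 (x * a)].
  case: nD => n D /=.
  have [[oD Dx]|nD] := pselect (open D /\ D x); last first.
    by exists x => oD Dx; case: nD.
  have [|a [Ba [Da Dxa]]] := xB n (D `&` [set a | D (x * a)]).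
    apply: open_nbhs_nbhs; split; first exact: openI (open_mull _ stX oD).
    by split=> //=; rewrite slmulxx.
  by exists a.
have [f fP] := choice pick.
pose D := fix D n := if n is m.+1 then
  D m `&` [set z | D m (f (m, D m) * z)] `&` E n else E 0.
pose a n := f (n, D n).
have Do n : open (D n) /\ D n x.
  elim: n => [|n [oDn Dnx]]; first exact: Eo.
  have [_ _ xa] := fP (n, D n) oDn Dnx.
  split; first by apply: openI (Eo _).1; apply: openI => //; exact: open_mull.
  by split; [split=> //=; rewrite slmulC|exact: (Eo _).2].
have aP n : [/\ B n (a n), D n (a n) & D n (x * a n)].
  by have [oD Dx] := Do n; exact: (fP (n, D n)).
have DS n m : (n <= m)%N -> D m `<=` D n.
  elim: m => [|m IH]; first by rewrite leqn0 => /eqP ->.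
  rewrite leq_eqVlt => /orP[/eqP -> //|/IH mn].
  by apply: subset_trans mn => z [[]].
have DE n : D n `<=` E n by case: n => [//|n] z [].
exists a => [n|k]; first by case: (aP n).
pose J := [set j | (k <= j)%N].
have Jtot i j : J i -> J j -> [\/ i = j, (i < j)%N | (j < i)%N].
  move=> _ _; case: (ltngtP i j) => ij;
    by [constructor 2|constructor 3|constructor 1].
pose lt i j := (i < j)%N.
exists [set y | exists j, ordered_product J lt a j y]; split.
- exact: subsemilattice_ordered_product Jtot.
- move=> y [j jy]; apply: DE.
  (* A further factor from [D j.+1] must be allowed, or the induction fails. *)
  suff [] : D k y /\ forall z, D j.+1 z -> D k (y * z) by [].
  elim: jy => {j y} [j kj|j l y jy [yk IH] kl jl].
    split; first by apply: (DS _ _ kj); case: (aP j).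
    by move=> z [[_ jz] _]; apply: (DS _ _ kj).
  have [_ Dal _] := aP l.
  split; first by rewrite slmulC; apply: IH; apply: (DS _ _ jl).
  move=> z [[_ lz] _]; rewrite (slmulC (a l)) -mulgA; apply: IH.
  exact: (DS _ _ jl).
- by move=> j kj; exists j; apply: ordered_product1.
Qed.

Lemma closure_countable_meet x A (E : nat -> set X) :
    semitopological_semilattice X -> complete_semilattice X ->
    subsemilattice A -> chain_closed A -> closure A x ->
    (forall n, open (E n) /\ E n x) ->
  exists2 c, A c & forall n, closure (E n) c.
Proof.
move=> stX cX Asub Acl xA Eo.
have [a aA aP] := @small_products x E (fun _ => A) stX Eo (fun _ => xA).
pose tail k := [set a j | j in [set j | (k <= j)%N]].
have [|||c [_ Ac cP]] := @lower_limit_exists (range tail) A cX Asub Acl.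
- by exists (tail 0); exists 0.
- move=> _ _ [k _ <-] [l _ <-].
  wlog kl : k l / (k <= l)%N.
    by case: (leqP k l) => [kl|/ltnW kl] /(_ _ _ kl) => // -[]; [right|left].
  by right => _ [j /= lj <-]; exists j => //=; exact: leq_trans lj.
- move=> _ [k _ <-]; split; first by move=> _ [j _ <-].
  by exists (a k); exists k => /=.
exists c => // n; have [P [Psub PE aPn]] := aP n.
apply: (closure_subset PE); apply: (cP (tail n)) => //.
by move=> _ [j /= nj <-]; exact: aPn.
Qed.

End topological.

(** * Topological semilattices *)

Section joint.
Context {d : Order.disp_t} {X : topologizedSemilatticeType d}.
Implicit Types (A B C D E P : set X) (x y z : X).

Lemma hausdorff_eq x y : hausdorff_space X ->
  (forall E, open E -> E x -> closure E y) -> x = y.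
Proof.
move=> hX xy; apply: hX => B C; rewrite nbhsE => -[E [oE Ex] EB] yC.
by have [z [Ez Cz]] := xy E oE Ex C yC; exists z; split=> //; exact: EB.
Qed.

(** For such sequences, joint continuity makes [nest_core U] a closed
    subsemilattice inside the closure of [U 0]. *)
Definition square_nested x (U : nat -> set X) :=
  (forall n, open (U n) /\ U n x) /\
  (forall n y z, U n.+1 y -> U n.+1 z -> U n (y * z)).

Definition nest_core (U : nat -> set X) := \bigcap_n closure (U n).

Lemma subsemilattice_nest_core x U : topological_semilattice X ->
  square_nested x U -> subsemilattice (nest_core U).
Proof.
move=> tX [_ Usq] y z Uy Uz n _ W yzW.
have [[W1 W2] [/= yW1 zW2] W12] := tX (y, z) W yzW.
have [y' [Uy' Wy']] := Uy n.+1 I _ yW1.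
have [z' [Uz' Wz']] := Uz n.+1 I _ zW2.
exists (y' * z'); split; first exact: Usq.
by apply: (W12 (y', z')).
Qed.

Lemma square_nested_exists x E : topological_semilattice X ->
  open E -> E x -> exists2 U, square_nested x U & U 0 = E.
Proof.
move=> tX oE Ex.
have half (O : set X) : exists O', open O -> O x ->
    [/\ open O', O' x & forall y z, O' y -> O' z -> O (y * z)].
  have [[oO Ox]|nO] := pselect (open O /\ O x); last first.
    by exists O => oO Ox; case: nO.
  have [|[W1 W2] [/=]] := tX (x, x) O.
    by apply: open_nbhs_nbhs; split=> //=; rewrite slmulxx.
  rewrite !nbhsE => -[V1 [oV1 V1x] VW1] [V2 [oV2 V2x] VW2] W12.
  exists (V1 `&` V2) => _ _; split=> //; first exact: openI.
  by move=> y z [/VW1 ? _] [_ /VW2 ?]; apply: (W12 (y, z)).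
have [h hP] := choice half.
have Uo n : open (iter n h E) /\ iter n h E x.
  by elim: n => // n [oU Ux]; have [] := hP _ oU Ux.
exists (fun n => iter n h E) => //; split=> // n.
by have [_ _] := hP _ (Uo n).1 (Uo n).2.
Qed.

(** The least points of the sets [K U] increase when [U] is refined.  Their
    supremum [s] is also the supremum of those that come from refinements of a
    fixed [U]; these lie in [K U], and so does [s]. *)
Lemma topological_chain_closed_closed A : topological_semilattice X ->
    semitopological_semilattice X -> hausdorff_space X ->
    complete_semilattice X -> subsemilattice A -> chain_closed A -> closed A.
Proof.
move=> tX stX hX cX Asub Acl x xA.
have cX' := complete_chain_complete cX.
pose K U := A `&` nest_core U.
have Ksub U : square_nested x U -> subsemilattice (K U).
  by move=> /subsemilattice_nest_core-/(_ tX); exact: subsemilatticeI.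
have Kcl U : chain_closed (K U).
  apply: chain_closedI => //; apply: closed_chain_closed => //.
  by apply: closed_bigI => n _; exact: closed_closure.
have K0 U : square_nested x U -> K U !=set0.
  move=> [Uo _].
  have [c Ac cU] := closure_countable_meet stX cX Asub Acl xA Uo.
  by exists c; split=> // n _; exact: cU.
have Kle U V : (forall n, V n `<=` U n) -> K V `<=` K U.
  move=> VU; apply: setIS => y Vy n _.
  by apply: (closure_subset (VU n)); exact: Vy.
have least U : square_nested x U -> exists2 i, infimums (K U) i & K U i.
  move=> Usq.
  exact: infimum_exists cX' (Ksub U Usq) (@subset_refl _ _) (Kcl U)
    (@subset_refl _ _) (K0 U Usq).
pose D U := [set i | exists V,
  [/\ square_nested x V, forall n, V n `<=` U n & infimums (K V) i]].
have meetsq V W : square_nested x V -> square_nested x W ->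
    square_nested x (fun n => V n `&` W n).
  move=> [Vo Vsq] [Wo Wsq].
  split=> [n|n y z [Vy Wy] [Vz Wz]]; last by split; [exact: Vsq|exact: Wsq].
  have [oV Vx] := Vo n; have [oW Wx] := Wo n.
  by split; [exact: openI|].
have refine U i V : square_nested x U -> square_nested x V ->
    infimums (K V) i -> exists2 j, D U j & (i <= j)%O.
  move=> Usq Vsq iV; have [j jW _] := least _ (meetsq _ _ Usq Vsq).
  exists j; last by apply: infimum_le jW iV; apply: Kle => n y [].
  exists (fun n => U n `&` V n); split; [exact: meetsq|by move=> n y []|].
  exact: jW.
have Ddir U : up_directed (D U).
  move=> i j [V [Vsq VU iV]] [W [Wsq WU jW]].
  have [k kV' _] := least _ (meetsq _ _ Vsq Wsq); exists k; split.
  - exists (fun n => V n `&` W n); split; [exact: meetsq| |exact: kV'].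
    by move=> n y [/VU].
  - by apply: infimum_le kV' iV; apply: Kle => n y [].
  - by apply: infimum_le kV' jW; apply: Kle => n y [].
have D0 U : square_nested x U -> D U !=set0.
  move=> Usq; have [i iU _] := least U Usq; exists i; exists U; split.
  - by [].
  - by move=> n.
  - by [].
(* Every nest refines the constant nest [W]. *)
pose W : nat -> set X := fun=> setT.
have Wsq : square_nested x W by split=> // n; split=> //; exact: openT.
have [s [sub slub]] := up_directed_supremum_exists cX' (D0 _ Wsq) (Ddir W).
have sK U : square_nested x U -> K U s.
  move=> Usq.
  have [KU _] := subsemilattice_chain_dedekind_closed cX' (Ksub U Usq) (Kcl U).
  apply: (KU (D U) _ (D0 U Usq) (Ddir U)).
    move=> i [V [Vsq VU iV]]; apply: (Kle _ _ VU).
    by have [j jV Kj] := least V Vsq; rewrite (infimum_unique iV jV).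
  split=> [i [V [Vsq _ iV]]|y yD]; first by apply: sub; exists V; split.
  apply: slub => i [V [Vsq _ iV]].
  by have [j Dj ij] := refine U i V Usq Vsq iV; apply: le_trans ij (yD _ Dj).
have -> : x = s; last by have [] := sK W Wsq.
apply: hausdorff_eq => // E oE Ex.
have [U Usq <-] := square_nested_exists tX oE Ex.
by have [_] := sK U Usq; apply.
Qed.
End joint.

(** * Sequential spaces *)

Section sequential.
Context {d : Order.disp_t} {X : topologizedSemilatticeType d}.
Implicit Types (A B C D E P : set X) (x y z : X).

Lemma closed_le x : semitopological_semilattice X -> hausdorff_space X ->
  closed [set y | (y <= x)%O].
Proof.
move=> [_ mulx] hX.
have -> : [set y | (y <= x)%O] = [set y | y * x = y].
  by apply/seteqP; split=> y /slmul_leP.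
move=> y yC; apply: hX => B C nB nC.
have nB' : nbhs y ((fun z => z * x) @^-1` B) by exact: mulx.
have [z [/= zx [Bz Cz]]] := yC _ (filterI nB' nC).
by exists z; split=> //; rewrite -zx.
Qed.

(** The lower set [L] generated by [S] lacks the supremum of [S], so it is not
    closed, and a sequence in [L] converges to a point outside.  Majorants of
    its terms in [S] are cofinal: an element of [S] above all of them would be
    above the limit. *)
Lemma sequential_chain_cofinal (S : set X) :
    semitopological_semilattice X -> hausdorff_space X ->
    complete_semilattice X -> sequential_space X ->
    S !=set0 -> chain S -> (forall x, S x -> exists2 y, S y & (x < y)%O) ->
  exists2 v : nat -> X, forall n, S (v n) &
    forall x, S x -> exists n, (x < v n)%O.
Proof.
move=> stX hX cX seqX S0 Sch Snomax.
have [_ [s sS sclS]] := cX S S0 Sch.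
pose L := [set y | exists2 x, S x & (y <= x)%O].
have Lcl : ~ closed L.
  move=> /(_ s) [|x Sx sx].
    by apply: closure_subset sclS => x Sx; exists x.
  have [y Sy xy] := Snomax x Sx.
  by have := lt_le_trans xy (le_trans (sS.1 y Sy) sx); rewrite ltxx.
have [u [y [uL Ly uy]]] := seqX L Lcl.
have /choice[v vP] n : exists x, S x /\ (u n <= x)%O.
  by have [x] := uL n; exists x.
exists v => [n|x Sx]; first by have [] := vP n.
apply: contrapT => nv; apply: Ly; exists x => //.
apply: (closed_le stX hX) => B /uy[N _ NB].
exists (u N); split; last by apply: NB => /=.
have [Sv uv] := vP N.
apply: le_trans uv _; case: (Sch _ _ Sv Sx) => // xv.
have [->|/eqP ne] := eqVneq x (v N); first by [].
by exfalso; apply: nv; exists N; rewrite lt_neqAle xv andbT; exact/eqP.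
Qed.

(** Instead of subsequences, reindexings that tend to infinity are used: they
    need not be monotone, which makes diagonal sequences easier to build. *)
Definition reindexing := {N : nat -> nat | forall n, (n <= N n)%N}.

(** Up to finitely many terms, a subsequence of [N]; the bound [k] says that
    the tails of [M] are eventually inside those of [N]. *)
Definition refines (M N : reindexing) := forall k, exists m, forall n,
  (m <= n)%N -> exists2 j, (k <= j)%N & sval M n = sval N j.

Lemma refines_refl N : refines N N.
Proof. by move=> k; exists k => n kn; exists n. Qed.

Lemma refines_trans M N L : refines L M -> refines M N -> refines L N.
Proof.
move=> LM MN k; have [m mP] := MN k; have [l lP] := LM m.
exists l => n /lP[j /mP[i ki ij] ->]; by exists i.
Qed.

(** A diagonal sequence: its term of rank [n] is a value of all of
    [N 0], ..., [N n], taken from one of these that refines the others. *)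
Lemma refines_common (N : nat -> reindexing) :
    (forall i j, refines (N i) (N j) \/ refines (N j) (N i)) ->
  exists M, forall i, refines M (N i).
Proof.
move=> Ntot.
have below n : exists T, forall i, (i <= n)%N -> refines (N T) (N i).
  elim: n => [|n [T IH]].
    by exists 0 => i; rewrite leqn0 => /eqP ->; exact: refines_refl.
  case: (Ntot T n.+1) => Tn.
    by exists T => i; rewrite leq_eqVlt => /orP[/eqP -> //|/IH].
  exists n.+1 => i; rewrite leq_eqVlt => /orP[/eqP ->|/IH].
    exact: refines_refl.
  exact: refines_trans.
have diag n : exists v, (n <= v)%N /\
    forall i, (i <= n)%N -> exists2 j, (n <= j)%N & v = sval (N i) j.
  have [T TP] := below n.
  suff [m mP] : exists m, forall i l, (i <= n)%N -> (m <= l)%N ->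
      exists2 j, (n <= j)%N & sval (N T) l = sval (N i) j.
    exists (sval (N T) (maxn m n)); split.
      by apply: leq_trans (proj2_sig (N T) _); rewrite leq_maxr.
    by move=> i ni; apply: mP => //; rewrite leq_maxl.
  have /choice[h hP] i : exists m, (i <= n)%N -> forall l, (m <= l)%N ->
      exists2 j, (n <= j)%N & sval (N T) l = sval (N i) j.
    case: (leqP i n) => [/TP/(_ n)[m mP]|_]; last by exists 0.
    by exists m => _.
  exists (\max_(i < n.+1) h i) => i l ni hl; apply: hP => //.
  by apply: leq_trans hl; rewrite -ltnS in ni; exact: (leq_bigmax (Ordinal ni)).
have [M MP] := choice diag.
exists (exist _ M (fun n => (MP n).1)) => i k.
exists (maxn i k) => n; rewrite geq_max => /andP[ni nk] /=.
have [_ /(_ i ni)[j nj ->]] := MP n.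
by exists j => //; apply: leq_trans nj.
Qed.

(** The lower limits [c N] of the sequences [u \o N] grow under refinement.  If
    [c N] is maximal then it is in the closure of every
    neighborhood of [x], since some refinement of [N] has this property. *)
Lemma sequential_chain_closed_closed A : sequential_space X ->
    semitopological_semilattice X -> hausdorff_space X ->
    complete_semilattice X -> subsemilattice A -> chain_closed A -> closed A.
Proof.
move=> seqX stX hX cX Asub Acl; apply: contrapT => nclA.
have cX' := complete_chain_complete cX.
have [u [x [uA Ax ux]]] := seqX A nclA; apply: Ax.
pose tail (N : reindexing) k := [set u (sval N j) | j in [set j | (k <= j)%N]].
have taill N k l : (k <= l)%N -> tail N l `<=` tail N k.
  by move=> kl _ [j /= lj <-]; exists j => //=; exact: leq_trans lj.
have tail0 N k : tail N k !=set0 by exists (u (sval N k)); exists k => /=.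
have tailA N k : tail N k `<=` A by move=> _ [j _ <-].
have /choice[c cP] N : exists c,
    [/\ supremums [set i | exists2 t, range (tail N) t & infimums t i] c, A c &
    forall t P, range (tail N) t -> subsemilattice P -> t `<=` P ->
      closure P c].
  apply: lower_limit_exists => //.
  - by exists (tail N 0); exists 0.
  - move=> _ _ [k _ <-] [l _ <-].
    by case: (leqP k l) => [kl|/ltnW kl]; [right|left]; exact: taill.
  - by move=> _ [k _ <-].
have tailx N k : closure (tail N k) x.
  move=> B /ux[m _ mB]; exists (u (sval N (maxn m k))); split.
    by exists (maxn m k); rewrite //= leq_maxr.
  by apply: mB; apply: leq_trans (proj2_sig N _); rewrite /= leq_maxl.
have cmono M N : refines M N -> (c N <= c M)%O.
  move=> MN; have [[_ club] _ _] := cP N; apply: club => i [_ [k _ <-] iN].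
  have [m mP] := MN k.
  have mk : tail M m `<=` tail N k.
    by move=> _ [n /= /mP[j kj ->] <-]; exists j.
  have [j jM _] := infimum_exists cX' Asub (@subset_refl _ A) Acl (@tailA M m)
    (tail0 M m).
  apply: le_trans (infimum_le mk jM iN) _.
  have [[cub _] _ _] := cP M; apply: cub; exists (tail M m) => //.
have near N E : open E -> E x -> exists2 M, refines M N & closure E (c M).
  move=> oE Ex.
  have [||a aN aE] := @small_products _ _ x (fun=> E) (tail N) stX.
  - by [].
  - exact: tailx.
  have /choice[h hP] n : exists j, (n <= j)%N /\ u (sval N j) = a n.
    by have [j nj <-] := aN n; exists j.
  have Mge n : (n <= sval N (h n))%N.
    by apply: leq_trans (proj2_sig N _); have [] := hP n.
  pose M : reindexing := exist _ (fun n => sval N (h n)) Mge.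
  exists M.
    move=> k; exists k => n kn; exists (h n) => //.
    by apply: leq_trans kn _; have [] := hP n.
  have [P [Psub PE aP]] := aE 0; apply: (closure_subset PE).
  have [_ _ cl] := cP M; apply: (cl (tail M 0)) => //.
  by move=> _ [j _ <-] /=; have [_ ->] := hP j; exact: aP.
(* Only refinements with a larger lower limit count as larger: then a chain
   without maximum has a cofinal sequence, read off from the lower limits. *)
pose R N M := N = M \/ refines M N /\ (c N < c M)%O.
have [||||N Nmax] := @Zorn reindexing (fun N M => `[< R N M >]).
- by move=> N; apply/asboolP; left.
- move=> N M L /asboolP[->//|[MN lt1]] /asboolP[<-|[LM lt2]]; apply/asboolP.
    by right.
  right; split; [exact: refines_trans LM MN|exact: lt_trans lt2].
- move=> N M /asboolP[//|[_ lt1]] /asboolP[//|[_ lt2]].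
  by have := lt_trans lt1 lt2; rewrite ltxx.
- move=> C Ctot0.
  have Ctot N M : C N -> C M -> R N M \/ R M N.
    by move=> CN CM; case: (Ctot0 N M CN CM) => /asboolP; [left|right].
  have [[N CN]|C0] := pselect (C !=set0); last first.
    exists (exist _ id (fun=> leqnn _)) => N CN.
    by exfalso; apply: C0; exists N.
  have [[M CM MC]|ntop] := pselect (exists2 M, C M & forall N, C N -> R N M).
    by exists M => L CL; apply/asboolP; exact: MC.
  have lt_refines M L : C M -> C L -> (c M < c L)%O -> refines L M.
    move=> CM CL ML; case: (Ctot M L CM CL) => -[E|[]//].
    - by move: ML; rewrite E ltxx.
    - by move: ML; rewrite E ltxx.
    - by move=> _ LM; have := lt_trans ML LM; rewrite ltxx.
  have [|||v vC vcof] := @sequential_chain_cofinal (c @` C) stX hX cX seqX.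
  - by exists (c N); exists N.
  - move=> _ _ [M CM <-] [L CL <-].
    by case: (Ctot M L CM CL) => -[->|[_ /ltW]]; [left|left|left|right].
  - move=> _ [M CM <-]; apply: contrapT => nM; apply: ntop; exists M => // L CL.
    case: (Ctot M L CM CL) => // -[->|[_ ML]]; first by left.
    by exfalso; apply: nM; exists (c L) => //; exists L.
  have /choice[K KP] n : exists K, C K /\ c K = v n.
    by have [K CK <-] := vC n; exists K.
  have [i j|M MK] := @refines_common K.
    have [Ki _] := KP i; have [Kj _] := KP j.
    case: (Ctot _ _ Ki Kj) => -[->|[ref _]].
    - by left; exact: refines_refl.
    - by right.
    - by left; exact: refines_refl.
    - by left.
  exists M => L CL; apply/asboolP; right.
  have [|n] := vcof (c L); first by exists L.
  have [CK <-] := KP n => LK.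
  split; first exact: refines_trans (MK n) (lt_refines _ _ CL CK LK).
  by apply: lt_le_trans LK _; exact: cmono.
suff -> : x = c N by have [] := cP N.
apply: hausdorff_eq => // E oE Ex.
have [M MN EM] := near N E oE Ex.
suff -> : c N = c M by [].
have := cmono M N MN; rewrite le_eqVlt => /orP[/eqP//|lt].
by rewrite -(Nmax M) //; apply/asboolP; right.
Qed.
End sequential.

(** * Approximation along families of open sets *)

Section delta.
Context {d : Order.disp_t} {X : topologizedSemilatticeType d}.
Implicit Types (A B C D E P : set X) (x y z : X).

(** The condition [residual b E] on a point [a] says that [b * a] meets the
    condition [E]. *)
Definition residual x E : set X := [set a | E (x * a)].

Section approximation.
Variables (x : X) (A : set X).
Variables (tests : set (set X)) (shrink : set X -> nat -> set X).
Hypothesis stX : semitopological_semilattice X.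
Hypothesis cX : complete_semilattice X.
Hypothesis tests_open : forall E, tests E -> open E.
Hypothesis tests_residual : forall p E, tests E -> tests (residual p E).
Hypothesis shrinkP : forall E, tests E -> E x ->
  (forall n, tests (shrink E n) /\ shrink E n x) /\
  \bigcap_n closure (shrink E n) `<=` E.
Hypothesis Asub : subsemilattice A.
Hypothesis Acl : chain_closed A.
Hypothesis xA : closure A x.

Let datum : choiceType := (X * set X)%type.
Implicit Type F : {fset datum}.

(** [tested F] is a set of conditions, of which [approximant F] meets those
    that [x] meets.  A datum brings a condition and a point by which conditions
    may be translated.  Indexing by finite sets of data leaves room for adding
    data to all the sets [tested F] at once, see [approximation_improve].
    Closure under [shrink] allows limits of points of [shrink E n], for all [n],
    to be found in [E]. *)
Record approximation := Approximation {
  tested : {fset datum} -> set (set X);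
  approximant : {fset datum} -> X;
  tested_mono : forall F F', (F `<=` F')%fset -> tested F `<=` tested F';
  tested_datum : forall F t, t \in F -> tests t.2 -> tested F t.2;
  tested_tests : forall F, tested F `<=` tests;
  tested_residualx : forall F E, tested F E -> tested F (residual x E);
  tested_residual : forall F t E, t \in F -> tested F E ->
    tested F (residual t.1 E);
  tested_shrink : forall F E n, tested F E -> E x -> tested F (shrink E n);
  approximantA : forall F, A (approximant F);
  approximantP : forall F E, tested F E -> E x -> E (approximant F)
}.

(** The least set of conditions that an approximation may test; it is countable,
    so that [closure_countable_meet] provides an approximant. *)
Inductive hull F : set X -> Prop :=
| hull_datum t : t \in F -> tests t.2 -> hull F t.2
| hull_residualx E : hull F E -> hull F (residual x E)
| hull_residual t E : t \in F -> hull F E -> hull F (residual t.1 E)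
| hull_shrink E n : hull F E -> E x -> hull F (shrink E n).

Lemma hull_tests F : hull F `<=` tests.
Proof.
move=> E; elim=> // {E} [E _|t E _ _|E n _]; try exact: tests_residual.
by move=> testE Ex; have [/(_ n)[]] := shrinkP testE Ex.
Qed.

Lemma hull_mono F F' : (F `<=` F')%fset -> hull F `<=` hull F'.
Proof.
move=> /fsubsetP FF' E; elim=> {E} [t /FF'|E _|t E /FF' tF _|E n _].
- exact: hull_datum.
- exact: hull_residualx.
- exact: hull_residual.
- exact: hull_shrink.
Qed.

Lemma hull_enum F : exists D : nat -> set X, forall E, hull F E ->
  exists n, D n = E.
Proof.
pose step (o : nat + option F) E : set X := match o with
  | inl n => shrink E n
  | inr None => residual x E
  | inr (Some t) => residual (val t).1 E
  end.
pose dec (c : F * seq (nat + option F)) := foldr step (val c.1).2 c.2.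
exists (fun n => if choice.unpickle n is Some c then dec c else setT).
suff codeP E : hull F E -> exists c, dec c = E.
  by move=> E /codeP[c <-]; exists (choice.pickle c); rewrite choice.pickleK.
elim=> {E} [t tF _|E _ [[t w] <-]|t E tF _ [[u w] <-]|E n _ [[t w] <-] _].
- by exists ([` tF]%fset, [::]).
- by exists (t, inr None :: w).
- by exists (u, inr (Some [` tF]%fset) :: w).
- by exists (t, inl n :: w).
Qed.

Lemma hull_approximant F : exists c, A c /\ forall E, hull F E -> E x -> E c.
Proof.
have [D DP] := hull_enum F.
pose D' n := if `[< hull F (D n) /\ D n x >] then D n else setT.
have [|c Ac cD] := @closure_countable_meet _ _ x A D' stX cX Asub Acl xA.
  move=> n; rewrite /D'; case: asboolP => [[hD Dx]|_].
    by split=> //; exact: tests_open (hull_tests hD).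
  by split=> //; exact: openT.
exists c; split=> // E hE Ex.
have [shrinkE] := shrinkP (hull_tests hE) Ex; apply=> n _.
have hG := hull_shrink n hE Ex; have [m mE] := DP _ hG.
have := cD m; rewrite /D' mE; case: asboolP => // -[]; split=> //.
by have [] := shrinkE n.
Qed.

Lemma approximation0 : inhabited approximation.
Proof.
have [c cP] := choice hull_approximant.
constructor; apply: (@Approximation hull c).
- exact: hull_mono.
- by move=> F t; exact: hull_datum.
- exact: hull_tests.
- exact: hull_residualx.
- by move=> F t E; exact: hull_residual.
- by move=> F E n; exact: hull_shrink.
- by move=> F; have [] := cP F.
- by move=> F E; have [_] := cP F; apply.
Qed.

(** Testing [residual (approximant s F) E] ensures that the product of the old
    and the new approximant satisfies [E]. *)
Definition improves s s' := forall F, tested s F `<=` tested s' F /\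
  forall E, tested s F E -> tested s' F (residual (approximant s F) E).

Lemma improves_trans s1 s2 s3 :
  improves s1 s2 -> improves s2 s3 -> improves s1 s3.
Proof.
move=> i12 i23 F; have [t12 a12] := i12 F; have [t23 a23] := i23 F.
by split=> [E /t12/t23//|E /a12/t23].
Qed.

Definition approximation_le s s' := s = s' \/ improves s s'.

Lemma approximation_le_trans s1 s2 s3 :
  approximation_le s1 s2 -> approximation_le s2 s3 -> approximation_le s1 s3.
Proof.
move=> [->//|i12] [<-|i23]; first by right.
by right; exact: improves_trans i23.
Qed.

Lemma approximation_le_tested s s' F : approximation_le s s' ->
  tested s F `<=` tested s' F.
Proof. by move=> [-> //|/(_ F)[]]. Qed.

(** The solution is a lower limit of the approximants along [C].  A condition
    [E] tested by [s] holds for every product of approximants of systems above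
    [s]: if [y] is a product of earlier ones, the next one satisfies
    [residual y E].  The point [x] meets this condition too, because [y]
    satisfies [residual x E]. *)
Lemma chain_approximant (C : set approximation) F : C !=set0 ->
    total_on C approximation_le ->
  exists c, A c /\ forall s E, C s -> tested s F E -> E x -> E c.
Proof.
move=> [s0 Cs0] Ctot.
pose J s := [set s' | C s' /\ approximation_le s s'].
pose b s := approximant s F.
pose tail s := b @` J s.
have Jtot s i j : J s i -> J s j -> [\/ i = j, improves i j | improves j i].
  move=> [Ci _] [Cj _]; case: (Ctot i j Ci Cj) => -[->|ij].
  - by constructor 1.
  - by constructor 2.
  - by constructor 1.
  - by constructor 3.
have Js s : C s -> J s s by move=> Cs; split=> //; left.
have [|||c [_ Ac cP]] := @lower_limit_exists _ _ (tail @` C) A cX Asub Acl.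
- by exists (tail s0); exists s0.
- have sub i j : approximation_le i j -> tail j `<=` tail i.
    move=> ij _ [k [Ck jk] <-]; exists k => //; split=> //.
    exact: approximation_le_trans ij jk.
  move=> _ _ [i Ci <-] [j Cj <-].
  by case: (Ctot i j Ci Cj) => /sub; [right|left].
- move=> _ [s Cs <-]; split; first by move=> _ [i _ <-]; exact: approximantA.
  by exists (b s); exists s => //; exact: Js.
exists c; split=> // s E Cs sE Ex.
pose P := [set y | exists j, ordered_product (J s) improves b j y].
have prodP j y : ordered_product (J s) improves b j y ->
    (forall D, tested s F D -> D x -> D y) /\
    (forall D k, tested s F D -> improves j k -> tested k F (residual y D)).
  elim=> {j y} [j [Cj sj]|j k y jy [yx yres] [Ck sk] jk].
    split=> [D sD|D k sD jk].
      by apply: approximantP; exact: approximation_le_tested sj _ sD.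
    have [_] := jk F; apply; exact: approximation_le_tested sj _ sD.
  split=> [D sD Dx|D l sD kl].
    have kD : tested k F (residual y D) by exact: yres.
    rewrite slmulC; apply: (approximantP kD); rewrite /residual /= slmulC.
    apply: (yx (residual x D)); first exact: tested_residualx.
    by rewrite /residual /= slmulxx.
  have -> : residual (b k * y) D = residual (b k) (residual y D).
    by rewrite /residual; apply/funext => a /=; rewrite (slmulC (b k)) mulgA.
  by have [_] := kl F; apply; exact: yres.
have [shrinkE] := shrinkP (@tested_tests s F E sE) Ex; apply=> n _.
apply: (@closure_subset _ P).
  move=> y [j /prodP[yx _]]; apply: yx; first exact: tested_shrink.
  by have [] := shrinkE n.
apply: (cP (tail s)); first by exists s.
- exact: subsemilattice_ordered_product (Jtot s).
- by move=> _ [j Jj <-]; exists j; exact: ordered_product1.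
Qed.

(** In a chain without maximum every member is improved by a later one, so the
    union tests the translates by all approximants of the chain. *)
Lemma chain_approximation (C : set approximation) :
  total_on C approximation_le ->
  exists s', forall s, C s -> approximation_le s s'.
Proof.
move=> Ctot.
have [C0|C0] := pselect (C !=set0); last first.
  have [s'] := approximation0.
  by exists s' => s Cs; exfalso; apply: C0; exists s.
have [[s' Cs' s'C]|ntop] := pselect (exists2 s', C s' &
    forall s, C s -> approximation_le s s').
  by exists s'.
have [c cP] := choice (fun F => chain_approximant F C0 Ctot).
pose H F : set (set X) := [set E | exists2 s, C s & tested s F E].
have [s' s'H] : exists s', tested s' = H.
  unshelve eexists (@Approximation H c _ _ _ _ _ _ _ _) => //.
  - move=> F F' FF' E [s Cs sE]; exists s => //; exact: tested_mono sE.
  - by move=> F t tF tE; have [s Cs] := C0; exists s => //; exact: tested_datum.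
  - by move=> F E [s _]; exact: tested_tests.
  - by move=> F E [s Cs sE]; exists s => //; exact: tested_residualx.
  - by move=> F t E tF [s Cs sE]; exists s => //; exact: tested_residual.
  - by move=> F E n [s Cs sE] Ex; exists s => //; exact: tested_shrink.
  - by move=> F; have [] := cP F.
  - by move=> F E [s Cs sE]; have [_ cE] := cP F; exact: cE Cs sE.
exists s' => s Cs; right=> F; rewrite s'H.
split=> [E sE|E sE]; first by exists s.
have [s1 Cs1 ss1] : exists2 s1, C s1 & improves s s1.
  apply: contrapT => n; apply: ntop; exists s => // s1 Cs1.
  case: (Ctot s s1 Cs Cs1) => // -[->|i]; first by left.
  by exfalso; apply: n; exists s1.
by exists s1 => //; have [_] := ss1 F; apply.
Qed.

(** The approximants of all subsets of [F], rather than that of [F] alone, are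
    added to [F], because [g] has to be monotone. *)
Lemma approximation_improve s E : tests E -> exists s', improves s s' /\
  tested s' fset0 E.
Proof.
move=> testE.
pose g F := (F `|` [fset (x, E)] `|`
  [fset (approximant s F', E) | F' in fpowerset F])%fset.
have gF F F' : (F `<=` F')%fset -> (g F `<=` g F')%fset.
  move=> FF'; apply: fsetUSS; first exact: fsetSU.
  apply/fsubsetP => t /imfsetP[K /= KF ->]; apply/imfsetP; exists K => //=.
  by move: KF; rewrite !fpowersetE => /fsubset_trans; apply.
have Fg F : (F `<=` g F)%fset.
  by rewrite /g -fsetUA; exact: fsubsetUl.
have bg F : (approximant s F, E) \in g F.
  rewrite in_fsetU; apply/orP; right; apply/imfsetP; exists F => //=.
  by rewrite fpowersetE.
unshelve eexists
  (@Approximation (tested s \o g) (approximant s \o g) _ _ _ _ _ _ _ _).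
- by move=> F F' /gF; exact: tested_mono.
- move=> F t tF tE; apply: tested_datum => //; exact: (fsubsetP (Fg F)).
- by move=> F; exact: tested_tests.
- by move=> F E'; exact: tested_residualx.
- move=> F t E' tF; apply: tested_residual; exact: (fsubsetP (Fg F)).
- by move=> F E' n; exact: tested_shrink.
- by move=> F; exact: approximantA.
- by move=> F E'; exact: approximantP.
split=> /= [F|].
  split=> [|E' sE']; first exact: tested_mono.
  apply: (@tested_residual s (g F) (approximant s F, E) E' (bg F)).
  exact: tested_mono sE'.
by apply: (@tested_datum s _ (x, E)); rewrite // !inE eqxx orbT.
Qed.

(** A maximal approximation tests every condition, already for the empty set of
    data. *)
Lemma closure_meet_family : exists2 c, A c & forall E, tests E -> E x -> E c.
Proof.
have [s0] := approximation0.
have [|||s smax] := @ZL_preorder approximation s0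
  (fun s s' => `[< approximation_le s s' >]).
- by move=> s; apply/asboolP; left.
- move=> s1 s2 s3 /asboolP i12 /asboolP i23; apply/asboolP.
  exact: approximation_le_trans i12 i23.
- move=> C Ctot; have [|s' s'C] := @chain_approximation C.
    by move=> i j Ci Cj; case: (Ctot i j Ci Cj) => /asboolP; [left|right].
  by exists s' => s Cs; apply/asboolP; exact: s'C.
exists (approximant s fset0); first exact: approximantA.
move=> E testE Ex; have [s' [ss' s'E]] := approximation_improve s testE.
apply: approximantP Ex.
have /smax/asboolP/approximation_le_tested : `[< approximation_le s s' >].
  by apply/asboolP; right.
by apply.
Qed.

End approximation.
End delta.

(** * Families of open sets that suffice *)

Section delta_regular.
Context {d : Order.disp_t} {X : topologizedSemilatticeType d}.
Implicit Types (A B C D E P : set X) (x y z : X).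

(** Such a family is in general neither a base of a topology nor stable under
    finite intersections: the preimages of open sets under single real functions
    form one if the functions separate points. *)
Definition delta_regular_family (opens : set (set X)) :=
  [/\ opens `<=` open,
      forall x y, x <> y -> exists2 U, opens U & U x /\ ~ U y &
      forall U x, opens U -> U x -> exists V : nat -> set X,
        (forall n, opens (V n) /\ V n x) /\ \bigcap_n closure (V n) `<=` U].

(** The conditions are [U (a * z)] for [U] in the family and [z] in [X]; the
    factor [z] makes them stable under [residual].  A solution [c] satisfies
    [c * z = x * z] for all [z], and [z := x] and [z := c] give [c = x]. *)
Lemma delta_regular_chain_closed_closed opens A : delta_regular_family opens ->
    semitopological_semilattice X ->
    complete_semilattice X -> subsemilattice A -> chain_closed A -> closed A.
Proof.
move=> [Oopen Osep Oreg] stX cX Asub Acl x xA.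
pose tests : set (set X) :=
  [set [set a | Uz.1 (a * Uz.2)] | Uz in [set Uz : set X * X | opens Uz.1]].
have tests_open E : tests E -> open E.
  by move=> [[U z] /= OU <-]; apply: open_mulr (Oopen _ OU).
have tests_residual p E : tests E -> tests (residual p E).
  move=> [[U z] /= OU <-]; exists (U, p * z) => //=.
  by apply/funext => a; rewrite /residual /= mulgA (slmulC a).
have /choice[shrink shrinkP] E : exists V : nat -> set X, tests E -> E x ->
    (forall n, tests (V n) /\ V n x) /\ \bigcap_n closure (V n) `<=` E.
  have [[[[U z] /= OU <-] Uxz]|nE] := pselect (tests E /\ E x); last first.
    by exists (fun=> setT) => testE Ex; exfalso; apply: nE.
  have [V [VO VU]] := Oreg U (x * z) OU Uxz.
  exists (fun n => [set a | V n (a * z)]) => _ _; split=> [n|a aV].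
    by have [OV Vxz] := VO n; split=> //; exists (V n, z).
  apply: VU => n _ B nB; have [_ /(_ z a B nB) naB] := stX.
  by have [c [Vc Bc]] := aV n I _ naB; exists (c * z).
have [c Ac cE] :=
  closure_meet_family stX cX tests_open tests_residual shrinkP Asub Acl xA.
have cz z : c * z = x * z.
  apply/esym; apply: contrapT => /Osep[U OU [Uxz]]; apply.
  by apply: (cE [set a | U (a * z)]) => //; exists (U, z).
suff -> : x = c by [].
by rewrite -(slmulxx x) -(cz x) slmulC -(cz c) slmulxx.
Qed.

Lemma vec_T2delta_delta_regular_family : vec_T2delta_space X ->
  exists opens, delta_regular_family opens.
Proof.
move=> [Y [f [[Y1 Yreg] finj fc]]].
have fopen V : open V -> open (f @^-1` V) by move/continuousP: fc; apply.
exists [set f @^-1` V | V in open]; split.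
- by move=> _ [V oV <-]; exact: fopen.
- move=> x y xy; have /Y1[V [oV]] : f x != f y.
    by apply/eqP => /finj.
  by rewrite !inE => Vx Vy; exists (f @^-1` V) => //; exists V.
- move=> _ x [V oV <-] /= Vx; have [F [Fcnt FP FV]] := Yreg V (f x) oV Vx.
  suff [g [gP gV]] : exists g : nat -> set Y,
      (forall n, closed (g n) /\ nbhs (f x) (g n)) /\ \bigcap_n g n `<=` V.
    exists (fun n => f @^-1` (g n)°); split=> [n|y yg].
      have [gcl gx] := gP n.
      split; last exact: nbhs_singleton (nbhs_interior gx).
      by exists (g n)° => //; exact: open_interior.
    apply: gV => n _; have [gcl _] := gP n; apply: gcl => B nB.
    have [z [gz Bz]] := yg n I _ (fc y B nB).
    by exists (f z); split=> //; exact: interior_subset gz.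
  have [F0|[g]] := pfcard_geP Fcnt.
    exists (fun=> setT); split=> [n|y _].
      by split; [exact: closedT|exact: filterT].
    by apply: FV => W; rewrite F0.
  exists g; split=> [n|y yg]; first by apply: FP; apply: funS.
  by apply: FV => W FW; have [n _ <-] := @surj _ _ setT F g W FW; exact: yg.
Qed.

Lemma functionally_hausdorff_delta_regular_family (R : realType) :
  functionally_hausdorff R X -> exists opens, delta_regular_family opens.
Proof.
move=> fhX.
exists [set U | exists f : X -> R, exists2 V, continuous f /\ open V &
  U = f @^-1` V]; split.
- by move=> _ [f [V [fc oV] ->]]; move/continuousP: fc; apply.
- move=> x y /fhX[f fc fxy].
  have [|V [oV]] := hausdorff_accessible (@Rhausdorff R) (x := f x) (y := f y).
    exact/eqP.
  by rewrite !inE => Vx Vy; exists (f @^-1` V) => //; exists f, V.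
- move=> _ x [f [V [fc oV] ->]] /= Vx.
  have [W nW WV] := @uniform_regular R (f x) V (open_nbhs_nbhs (conj oV Vx)).
  exists (fun=> f @^-1` W°); split=> [n|y /(_ 0 I) yW].
    split; last exact: nbhs_singleton (nbhs_interior nW).
    by exists f; exists W° => //; split=> //; exact: open_interior.
  apply: WV => B nB; have [z [Wz Bz]] := yW _ (fc y B nB).
  by exists (f z); split=> //; exact: interior_subset Wz.
Qed.

End delta_regular.

(** * Coincidence of the two topologies *)

Theorem theorem9p1 (R : realType) (d : Order.disp_t)
    (X : topologizedSemilatticeType d)
    (X_semitop : semitopological_semilattice X)
    (X_hausdorff : hausdorff_space X)
    (X_complete : complete_semilattice X)
    (X_cond : [\/ topological_semilattice X,
                  sequential_space X,
                  vec_T2delta_space X |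
                  functionally_hausdorff R X]) :
  weak_bullet_topology X = lower_complete_topology X.
Proof.
have chain_closed_closed (A : set X) :
    subsemilattice A -> chain_closed A -> closed A.
  move=> Asub Acl; case: X_cond => [tX|seqX|vX|fhX].
  - exact: (topological_chain_closed_closed tX X_semitop X_hausdorff X_complete
      Asub Acl).
  - exact: (sequential_chain_closed_closed seqX X_semitop X_hausdorff X_complete
      Asub Acl).
  - have [opens opensP] := vec_T2delta_delta_regular_family vX.
    exact: (delta_regular_chain_closed_closed opensP X_semitop X_complete
      Asub Acl).
  - have [opens opensP] := functionally_hausdorff_delta_regular_family fhX.
    exact: (delta_regular_chain_closed_closed opensP X_semitop X_complete
      Asub Acl).
have subbaseE : @weak_bullet_subbase d X = @lower_complete_subbase d X.
  apply/seteqP; split=> _ [A [Acl Asub] <-]; exists A => //; split=> //.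
    apply: subsemilattice_chain_dedekind_closed Asub _.
      exact: complete_chain_complete.
    exact: closed_chain_closed.
  exact/(chain_closed_closed _ Asub)/dedekind_closed_chain_closed.
(* Both types are [X], and the same construction turns their subbases into
   topologies. *)
pose generated (S : set (set X)) : set (set X) :=
  [set \bigcup_(U in D) U | D in subset^~ (finI_from S id)].
change (generated (@weak_bullet_subbase d X) =
        generated (@lower_complete_subbase d X)).
by rewrite subbaseE.
Qed.
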